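(* Let $\mathbf P\in\mathcal P$ be such that $\mathbf P\vdash\mathcal Q$ is nonzero. Then the expected mean square for $\mathbf P\vdash\mathcal Q$ is $\xi_{\mathbf P}$.
   Context: Setting (chain of two randomizations). $\Omega,\Upsilon,\Gamma$ are finite sets, $f\colon\Omega\to\Upsilon$ and $h\colon\Upsilon\to\Gamma$ are surjective maps, and $f$ is equireplicate: every element of $\Upsilon$ has exactly $r$ preimages. $\mathbf X_f$ is the $\Omega\times\Upsilon$ matrix with $(\omega,\upsilon)$-entry $1$ if $f(\omega)=\upsilon$ and $0$ otherwise; $\mathbf X_h$ is the analogous $\Upsilon\times\Gamma$ matrix; $\mathbf D_h=\mathbf X_h'\mathbf X_h$. Primes denote transposes. A transitive permutation group $G$ on a finite set $S$ is stratifiable if the symmetric $0$-$1$ matrices of its symmetrized orbits on $S\times S$ all commute; the orthogonal projectors onto their common eigenspaces (strata) are its stratum projectors. $\mathcal P$ is the set of stratum projectors ($\Omega\times\Omega$ nonzero symmetric, mutually orthogonal idempotents summing to $\mathbf I_\Omega$) of a transitive stratifiable group $G_1$ on $\Omega$. $\mathcal Q$ arises from the stratum projectors $\mathbf Q_\Upsilon$ ($\Upsilon\times\Upsilon$, summing to $\mathbf I_\Upsilon$) of a transitive stratifiable group $G_2$ on $\Upsilon$ (or from a refinement in which some of these are replaced by mutually orthogonal nonzero symmetric sub-idempotents summing to them, all pieces keeping the same coefficient $\eta$): each $\mathbf Q_\Upsilon$ is replaced by the $\Omega\times\Omega$ matrix $\mathbf Q=r^{-1}\mathbf X_f\mathbf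 Q_\Upsilon\mathbf X_f'$. These are mutually orthogonal symmetric idempotents with sum $\mathbf I_{\mathcal Q}=r^{-1}\mathbf X_f\mathbf X_f'$. $\mathcal R$ arises from a set of nonzero symmetric, mutually orthogonal $\Upsilon\times\Upsilon$ idempotents $\mathbf R_\Upsilon$ with sum $\mathbf X_h\mathbf D_h^{-1}\mathbf X_h'$, each replaced by $\mathbf R=r^{-1}\mathbf X_f\mathbf R_\Upsilon\mathbf X_f'$; put $\mathbf I_{\mathcal R}=\sum_{\mathbf R\in\mathcal R}\mathbf R$. Model. $\mathbf Y=\mathbf Z+\mathbf X_f\mathbf W+\mathbf X_f\mathbf X_h\boldsymbol\tau$, where $\boldsymbol\tau\in\mathbb R^\Gamma$ is a fixed vector, $\mathbf Z$ (indexed by $\Omega$) and $\mathbf W$ (indexed by $\Upsilon$) are independent random vectors with mean zero, $\operatorname{Cov}(\mathbf Z)=\sum_{\mathbf P}\xi_{\mathbf P}\mathbf P$ and $\operatorname{Cov}(\mathbf W)=\sum\eta_{\mathbf Q}\mathbf Q_\Upsilon$ with $\xi_{\mathbf P},\eta_{\mathbf Q}\ge 0$. Thus $\operatorname E(\mathbf Y)=\mathbf X_f\mathbf X_h\boldsymbol\tau$ and $\operatorname{Cov}(\mathbf Y)=\mathbf V=\sum_{\mathbf P\in\mathcal P}\xi_{\mathbf P}\mathbf P+r\sum_{\mathbf Q\in\mathcal Q}\eta_{\mathbf Q}\mathbf Q$. Structure balance (assumed). $\mathcal Q$ is structure balanced in relation to $\mathcal P$: there are scalars $\lambda_{\mathbf{PQ}}$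 with $\mathbf Q\mathbf P\mathbf I_{\mathcal Q}=\lambda_{\mathbf{PQ}}\mathbf Q$ for all $\mathbf P\in\mathcal P$, $\mathbf Q\in\mathcal Q$. $\mathcal R$ is structure balanced in relation to $\mathcal Q$: there are scalars $\lambda_{\mathbf{QR}}$ with $\mathbf R\mathbf Q\mathbf I_{\mathcal R}=\lambda_{\mathbf{QR}}\mathbf R$ for all $\mathbf Q\in\mathcal Q$, $\mathbf R\in\mathcal R$. Derived idempotents. If $\lambda_{\mathbf{PQ}}\ne0$, $\mathbf P\vartriangleright\mathbf Q=\lambda_{\mathbf{PQ}}^{-1}\mathbf{PQP}$; and $\mathbf P\vdash\mathcal Q=\mathbf P-\sum_{\mathbf Q\in\mathcal Q:\lambda_{\mathbf{PQ}}\ne0}\mathbf P\vartriangleright\mathbf Q$. The mean square for a nonzero symmetric idempotent $\mathbf A$ is $\mathbf Y'\mathbf A\mathbf Y/\operatorname{rank}(\mathbf A)$, and the expected mean square is its expectation. *)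

(* Defs.v *)
From mathcomp Require Import all_boot all_order all_algebra all_fingroup.
From mathcomp Require Import all_classical all_reals all_analysis.

Set Implicit Arguments.
Unset Strict Implicit.
Unset Printing Implicit Defensive.

Import Order.TTheory GRing.Theory Num.Theory.

Local Open Scope ring_scope.

(* Matrices and vectors indexed by a finite set S live in dimension #|S|,
   position i standing for the element enum_val i of S. *)

Section IndexedByFinType.
Context {R : nzRingType}.

Definition vec_of (S : finType) (x : S -> R) : 'cV[R]_#|S| :=
  \col_i x (enum_val i).

Definition incidence_mx (A B : finType) (f : A -> B) : 'M[R]_(#|A|, #|B|) :=
  \matrix_(i, j) (f (enum_val i) == enum_val j)%:R.

End IndexedByFinType.

Definition equireplicate (A B : finType) (f : A -> B) (r : nat) : Prop :=
  forall b, #|[pred a | f a == b]| = r.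

Definition orth_idempotents (R : nzRingType) (I : finType) (n : nat)
    (P : I -> 'M[R]_n) : Prop :=
  [/\ forall i, P i != 0,
      forall i, (P i)^T = P i,
      forall i, P i *m P i = P i
    & forall i j, i != j -> P i *m P j = 0].

Section Strata.
Variables (R : realType) (S : finType).

(* The union of the G-orbit of (x, y) on S x S with its mirror image. *)
Definition sym_orbital (G : {group {perm S}}) (x y : S) : {set S * S} :=
  ([set (g x, g y) | g : {perm S} in G]
   :|: [set (g y, g x) | g : {perm S} in G])%SET.

Definition sym_orbital_mx (G : {group {perm S}}) (x y : S) : 'M[R]_#|S| :=
  \matrix_(i, j) ((enum_val i, enum_val j) \in sym_orbital G x y)%:R.

Definition transitive_group (G : {group {perm S}}) : bool :=
  [transitive G, on [set: S]%SET | 'P].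

Definition stratifiable (G : {group {perm S}}) : Prop :=
  forall x y z t : S,
    comm_mx (sym_orbital_mx G x y) (sym_orbital_mx G z t).

(* P is the orthogonal projector onto a nonzero common eigenspace, theta x y
   being the eigenvalue of the matrix of the symmetrized orbit of (x, y).
   The matrices involved are symmetric, so the row spaces used by eigenspace
   amount to column spaces. *)
Definition stratum_projector (G : {group {perm S}}) (P : 'M[R]_#|S|) : Prop :=
  [/\ P != 0, P^T = P, P *m P = P
    & exists theta : S -> S -> R,
        (P :=: \bigcap_(xy : S * S)
                 eigenspace (sym_orbital_mx G xy.1 xy.2) (theta xy.1 xy.2))%MS].

Definition stratum_projectors (G : {group {perm S}})
    (I : finType) (P : I -> 'M[R]_#|S|) : Prop :=
  injective P /\
  forall M : 'M[R]_#|S|, stratum_projector G M <-> exists i, P i = M.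

(* Q splits each member of P into mutually orthogonal nonzero symmetric
   sub-idempotents, Q j being a piece of P (parent j).  Members that are not
   split have a single piece; for parent a bijection, Q is P itself. *)
Definition refinement (K J : finType) (P : K -> 'M[R]_#|S|)
    (parent : J -> K) (Q : J -> 'M[R]_#|S|) : Prop :=
  orth_idempotents Q /\
  forall k, \sum_(j | parent j == k) Q j = P k.

End Strata.

Section Balance.
Variable R : realType.

(* The matrix r^-1 X_f M X_f' over A attached to a matrix M over B. *)
Definition lift_mx (A B : finType) (f : A -> B) (r : nat) (M : 'M[R]_#|B|) :
    'M[R]_#|A| :=
  r%:R^-1 *: (incidence_mx f *m M *m (incidence_mx f)^T).

(* X_h' X_h is invertible as soon as h is surjective. *)
Definition proj_incidence (A B : finType) (h : A -> B) : 'M[R]_#|A| :=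
  let X := incidence_mx h in X *m invmx (X^T *m X) *m X^T.

Definition structure_balanced (I J : finType) (n : nat)
    (P : I -> 'M[R]_n) (Q : J -> 'M[R]_n) (lambda : I -> J -> R) : Prop :=
  forall i j, Q j *m P i *m (\sum_j' Q j') = lambda i j *: Q j.

(* P |> Q, for l = lambda_PQ nonzero *)
Definition pertinent (n : nat) (l : R) (P Q : 'M[R]_n) : 'M[R]_n :=
  l^-1 *: (P *m Q *m P).

(* P |- Q for the family Q *)
Definition residual (I J : finType) (n : nat) (P : I -> 'M[R]_n)
    (Q : J -> 'M[R]_n) (lambda : I -> J -> R) (i : I) : 'M[R]_n :=
  P i - \sum_(j | lambda i j != 0) pertinent (lambda i j) (P i) (Q j).

End Balance.

Section RandomVectors.
Context {d : measure_display} {T : measurableType d} {R : realType}.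
Variable Pr : probability T R.

Definition centred (S : finType) (X : S -> {RV Pr >-> R}) : Prop :=
  forall s, ('E_Pr[X s] = 0)%E.

(* Square integrability makes the entries of the covariance matrix finite and
   meaningful: expectation is total in the library. *)
Definition has_covariance (S : finType) (X : S -> {RV Pr >-> R})
    (V : 'M[R]_#|S|) : Prop :=
  (forall s, (X s : T -> R) \in Lfun Pr 2%:E) /\
  forall i j : 'I_#|S|, covariance Pr (X (enum_val i)) (X (enum_val j)) = (V i j)%:E.

(* The sigma-algebra generated by the whole vector X. *)
Definition sigma_rv (S : finType) (X : S -> {RV Pr >-> R}) : set (set T) :=
  <<s [set A | exists s, exists2 B : set R,
                 measurable B & A = X s @^-1` B]%classic >>.

Definition independent_vectors (S S' : finType)
    (X : S -> {RV Pr >-> R}) (Y : S' -> {RV Pr >-> R}) : Prop :=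
  forall A B : set T, sigma_rv X A -> sigma_rv Y B ->
    (Pr (A `&` B)%classic = Pr A * Pr B)%E.

Definition response (Om Up Ga : finType) (f : Om -> Up) (h : Up -> Ga)
    (Z : Om -> {RV Pr >-> R}) (W : Up -> {RV Pr >-> R}) (tau : Ga -> R)
    (t : T) : 'cV[R]_#|Om| :=
  vec_of (fun w => Z w t)
  + incidence_mx f *m vec_of (fun u => W u t)
  + incidence_mx f *m incidence_mx h *m vec_of tau.

Definition mean_square (n : nat) (A : 'M[R]_n) (Y : T -> 'cV[R]_n) (t : T) : R :=
  ((Y t)^T *m A *m Y t) 0 0 / (\rank A)%:R.

Definition expected_mean_square (n : nat) (A : 'M[R]_n) (Y : T -> 'cV[R]_n) :
    \bar R :=
  ('E_Pr[mean_square A Y])%E.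

End RandomVectors.

(* Main.v *)
Require Import Defs.
From mathcomp Require Import all_boot all_order all_algebra all_fingroup.
From mathcomp Require Import complex ring.
From mathcomp Require Import all_classical all_reals all_analysis.

Set Implicit Arguments.
Unset Strict Implicit.
Unset Printing Implicit Defensive.

Import Order.TTheory GRing.Theory Num.Theory.

Local Open Scope ring_scope.

(** The strata of a stratifiable group sum to the identity: commuting real
symmetric matrices are simultaneously diagonalizable, so every vector of a
common eigenbasis lies in some stratum.  Hence the matrices Q sum to
r^-1 X_f X_f'.  Balance gives Q P Q' = lambda_PQ Q Q', from which P |- Q
annihilates every Q, hence also X_f; so only Z contributes to the quadratic
form Y' (P |- Q) Y.  Its expectation is the trace of (P |- Q) Cov(Z) =
xi_P (P |- Q), and the trace of an idempotent is its rank. *)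

(** * Idempotents, symmetric matrices and orthogonal projectors *)

(** In a full-rank factorization [A = C *m B], idempotence forces [B *m C = 1%:M], of size the rank;
    the trace is unchanged when the factors are swapped. *)
Lemma mxtrace_idempotent (F : fieldType) (n : nat) (A : 'M[F]_n) :
  A *m A = A -> \tr A = (\rank A)%:R.
Proof.
move=> AA.
move: (mulmx_base A) (col_base_full A) (row_base_free A).
move: (col_base A) (row_base A) => C B CB /row_fullP[C' C'C] freeB.
rewrite -{1}CB mxtrace_mulC; suff -> : B *m C = 1%:M by rewrite mxtrace1.
apply: (row_free_inj freeB); rewrite mul1mx -[LHS]mul1mx -C'C.
by rewrite -!mulmxA (mulmxA C) CB AA -[RHS]mul1mx -C'C -mulmxA CB.
Qed.

Lemma symmetric_diagonalizable (R : rcfType) (n : nat) (A : 'M[R]_n) :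
  A^T = A -> diagonalizable A.
Proof.
case: n A => [|n] A symA; first by rewrite [A]thinmx0; exact: diagonalizable0.
pose toC : {rmorphism R -> R[i]} := real_complex R.
(* The spectrum of the complexification is real, so the minimal polynomial
   already splits into distinct linear factors over R. *)
have hermA : map_mx toC A \is hermsymmx.
  apply: realsym_hermsym.
    by apply/is_hermitianmxP; rewrite expr0 scale1r map_mx_id // map_trmx symA.
  by apply/mxOverP => i j; rewrite mxE /= complex_real.
have /mxOverP real_sp := hermitian_spectral_diag_real hermA.
have /orthomx_spectralP := hermitian_normalmx hermA.
have P_unit := spectral_unit (map_mx toC A).
set sp := spectral_diag _ in real_sp *; move=> defA.
pose rs := undup [seq complex.Re (sp 0 i) | i <- enum 'I_n.+1].
apply/diagonalizableP; exists rs; first exact: undup_uniq.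
suff -> : mxminpoly A = \prod_(x <- rs) ('X - x%:P) by [].
apply: (map_poly_inj toC); rewrite -mxminpoly_map.
rewrite defA -conjVmx // mxminpoly_uconj ?unitmx_inv // mxminpoly_diag.
rewrite rmorph_prod /rs.
have toC_Re i : toC (complex.Re (sp 0 i)) = sp 0 i.
  by apply: RRe_real; exact: real_sp.
rewrite -(@eq_map _ _ _ _ toC_Re) (map_comp toC) undup_map_inj; last exact: fmorph_inj.
by rewrite big_map; apply: eq_bigr => x _; rewrite /= map_polyXsubC.
Qed.

Lemma mulmx_idempotent_id (F : fieldType) (m n : nat) (A : 'M[F]_(m, n)) (E : 'M[F]_n) :
  E *m E = E -> (A <= E)%MS -> A *m E = A.
Proof. by move=> EE /submxP[D ->]; rewrite -mulmxA EE. Qed.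

(** The diagonal entries of [A *m A^T] are the sums of squares of the rows of [A]. *)
Lemma mulmx_trmx_eq0 (R : realDomainType) (m n : nat) (A : 'M[R]_(m, n)) :
  A *m A^T = 0 -> A = 0.
Proof.
move=> AA0; apply/matrixP => i j; move/matrixP/(_ i i): AA0.
rewrite !mxE => /psumr_eq0P AA0; apply/eqP; rewrite -sqrf_eq0 expr2.
have := AA0 _ j isT; rewrite mxE => -> // k _.
by rewrite mxE -expr2 sqr_ge0.
Qed.

(** For a basis [B] of the row space, the projector is [B^T (B B^T)^-1 B]. *)
Lemma orthogonal_projector_exists (R : realFieldType) (m n : nat) (U : 'M[R]_(m, n)) :
  exists P : 'M[R]_n, [/\ P^T = P, P *m P = P & (P :=: U)%MS].
Proof.
move: (row_base U) (row_base_free U) (eq_row_base U) => B freeB eqB.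
pose G := B *m B^T.
have unitG : G \in unitmx.
  (* If [v] kills the Gram matrix, then [(v B)(v B)^T = 0], so [v B = 0], and [v = 0] since [B] is
     row free. *)
  rewrite -row_free_unit; apply/inj_row_free => v vG0.
  apply/eqP; rewrite -(mulmx_free_eq0 v freeB); apply/eqP/mulmx_trmx_eq0.
  by rewrite trmx_mul mulmxA -(mulmxA v) -/G vG0 mul0mx.
have symG : G^T = G by rewrite trmx_mul trmxK.
pose P := B^T *m invmx G *m B.
have BP : B *m P = B by rewrite /P !mulmxA -/G mulmxV // mul1mx.
exists P; split.
- by rewrite /P !trmx_mul trmxK trmx_inv symG mulmxA.
- by have -> : P *m P = B^T *m invmx G *m (B *m P); [rewrite mulmxA | rewrite BP].
- apply: eqmx_trans eqB; apply/eqmxP.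
  by apply/andP; split; [exact: submxMl | rewrite -BP; exact: submxMl].
Qed.

(** Equal row spaces give [P Q = P] and [Q P = Q]; transposing the first gives [Q P = P]. *)
Lemma symmetric_idempotents_eqmx (F : fieldType) (n : nat) (P Q : 'M[F]_n) :
  P^T = P -> Q^T = Q -> P *m P = P -> Q *m Q = Q -> (P :=: Q)%MS -> P = Q.
Proof.
move=> Ps Qs PP QQ PQ.
have <- : P *m Q = P by apply: mulmx_idempotent_id; rewrite ?PQ.
by rewrite -[LHS]trmxK trmx_mul Ps Qs mulmx_idempotent_id // ?PQ.
Qed.

(** * Strata of a stratifiable group *)

Section Strata.
Variables (R : realType) (S : finType) (G : {group {perm S}}).

Lemma sym_orbital_mx_sym (x y : S) :
  (sym_orbital_mx R G x y)^T = sym_orbital_mx R G x y.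
Proof.
apply/matrixP => i j; rewrite !mxE; congr (nat_of_bool _)%:R.
suff imp a b : (a, b) \in sym_orbital G x y -> (b, a) \in sym_orbital G x y.
  by apply/idP/idP; exact: imp.
by rewrite !inE orbC => /orP[] /imsetP[g Gg [-> ->]]; apply/orP; [left|right];
  apply/imsetP; exists g.
Qed.

Lemma stratum_eigen (P : 'M[R]_#|S|) (theta : S -> S -> R) :
  (P :=: \bigcap_(xy : S * S)
           eigenspace (sym_orbital_mx R G xy.1 xy.2) (theta xy.1 xy.2))%MS ->
  forall x y, P *m sym_orbital_mx R G x y = theta x y *: P.
Proof.
move=> defP x y; apply/eigenspaceP; rewrite defP.
by move/sub_bigcapmxP: (submx_refl (\bigcap_(xy : S * S)
  eigenspace (sym_orbital_mx R G xy.1 xy.2) (theta xy.1 xy.2))%MS) => /(_ (x, y) isT).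
Qed.

(** Distinct strata have different eigenvalues [t] and [u] for some symmetrized orbit matrix [M];
    evaluating [P M Q] from both sides gives [t P Q = u P Q]. *)
Lemma stratum_projectors_orth (P Q : 'M[R]_#|S|) :
  stratum_projector G P -> stratum_projector G Q -> P != Q -> P *m Q = 0.
Proof.
move=> [_ Psym PP [t defP]] [_ Qsym QQ [u defQ]] PQ.
have [tu|] := pselect (forall x y, t x y = u x y).
  case/eqP: PQ; apply: symmetric_idempotents_eqmx => //.
  apply: eqmx_trans defP _; apply: eqmx_trans _ (eqmx_sym defQ).
  by under eq_bigr do rewrite tu.
move=> /existsNP[x /existsNP[y /eqP]]; rewrite -subr_eq0 => tu.
suff: (t x y - u x y) *: (P *m Q) == 0.
  by rewrite scaler_eq0 (negbTE tu) => /eqP.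
rewrite scalerBl subr_eq0 scalemxAl -(stratum_eigen defP) scalemxAr -mulmxA.
apply/eqP; congr (_ *m _).
by rewrite -[LHS]trmxK trmx_mul sym_orbital_mx_sym Qsym (stratum_eigen defQ)
  linearZ /= Qsym.
Qed.

(** It suffices that the sum fixes each row of an invertible [U] whose rows are common
    eigenvectors. *)
Lemma sum_stratum_projectors (K : finType) (P : K -> 'M[R]_#|S|) :
  stratifiable R G -> stratum_projectors G P -> \sum_k P k = 1%:M.
Proof.
move=> commG [P_inj P_strata].
have strP k : stratum_projector G (P k) by apply/P_strata; exists k.
pose As := [seq sym_orbital_mx R G xy.1 xy.2 | xy <- enum {: S * S}].
have [|U U_unit /allP diagU] := (codiagonalizableP As).1.
  split; first by move=> _ _ /mapP[xy _ ->] /mapP[zt _ ->]; exact: commG.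
  by move=> _ /mapP[xy _ ->]; apply: symmetric_diagonalizable; exact: sym_orbital_mx_sym.
apply: (can_inj (mulKmx U_unit)); rewrite mulmx1; apply/row_matrixP => i.
rewrite row_mul; set v := row i U.
have v_neq0 : v != 0.
  rewrite /v rowE mulmx_free_eq0 ?row_free_unit //.
  by apply/eqP => /matrixP/(_ 0 i)/eqP; rewrite !mxE !eqxx oner_eq0.
(* The eigenvalues of [v] single out the common eigenspace [E]; it contains [v], hence is nonzero,
   and its projector must be some [P k]. *)
have /choice[theta vtheta] (xy : S * S) :
    exists t, v *m sym_orbital_mx R G xy.1 xy.2 = t *: v.
  have /diagU/similar_diagPex[D /(similarP U_unit) UD] :
    sym_orbital_mx R G xy.1 xy.2 \in As by apply: map_f; rewrite mem_enum.
  by exists (D 0 i); rewrite -row_mul UD row_mul row_diag_mx -scalemxAl -rowE.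
pose E := (\bigcap_(xy : S * S) eigenspace (sym_orbital_mx R G xy.1 xy.2) (theta xy))%MS.
have vE : (v <= E)%MS.
  by apply/sub_bigcapmxP => xy _; apply/eigenspaceP.
have [P0 [P0sym P0P0 defP0]] := orthogonal_projector_exists E.
have [k Pk] : exists k, P k = P0.
  apply/P_strata; split=> //.
    by apply: contraNneq v_neq0 => P0_eq0; rewrite -submx0 -P0_eq0 defP0.
  exists (fun x y => theta (x, y)); apply: eqmx_trans defP0 _.
  by rewrite /E; under eq_bigr do rewrite [X in theta X]surjective_pairing.
have vPk : v *m P k = v.
  by apply: mulmx_idempotent_id; rewrite Pk // defP0.
(* As [v = v P k], orthogonality makes every other projector kill [v]. *)
rewrite mulmx_sumr (bigD1 k) //= vPk big1 ?addr0 // => l lk.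
rewrite -vPk -mulmxA (stratum_projectors_orth (strP k) (strP l)) ?mulmx0 //.
by rewrite (inj_eq P_inj) eq_sym.
Qed.

End Strata.

(** * Expectation of a quadratic form in a random vector *)

Section QuadraticForm.
Variables (R : realType) (d : measure_display) (T : measurableType d).
Variables (Pr : probability T R) (S : finType) (X : S -> {RV Pr >-> R}).
Variables V A : 'M[R]_#|S|.
Hypothesis X_cov : has_covariance X V.

Let quadratic_form t := (((vec_of (X^~ t))^T *m A *m vec_of (X^~ t)) 0 0)%R.

(** A list of functions is the shape to which [expectation_sum] applies. *)
Let quadratic_terms : seq (T -> R) :=
  [seq A ij.1 ij.2 \o* (X (enum_val ij.2) \* X (enum_val ij.1))
     | ij <- enum {: 'I_#|S| * 'I_#|S|}].

Let quadratic_formE : quadratic_form = \sum_(Y <- quadratic_terms) Y.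
Proof.
apply/funext => t; rewrite big_map big_enum /= fct_sumE /quadratic_form.
rewrite mxE; under eq_bigr do rewrite mxE mulr_suml.
rewrite exchange_big pair_big /=; apply: eq_bigr => -[i j] _ /=.
by rewrite !mxE; ring.
Qed.

Let product_Lfun1 s s' : X s \* X s' \in Lfun Pr 1%E.
Proof. by apply: Lfun2_mul_Lfun1; exact: (X_cov.1). Qed.

Let quadratic_terms_Lfun1 Y : Y \in quadratic_terms -> Y \in Lfun Pr 1%E.
Proof. by move=> /mapP[ij _ ->]; exact: Lfun_scale. Qed.

(** Products of square integrable entries are integrable. This later allows the factor [1 / rank] to
    be pulled out of the expectation. *)
Lemma quadratic_form_Lfun1 : quadratic_form \in Lfun Pr 1%E.
Proof.
rewrite quadratic_formE big_seq; apply: rpred_sum => Y.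
exact: quadratic_terms_Lfun1.
Qed.

(** For centred entries the expectation of [X_j X_i] is [V j i], and the sum of [A i j * V j i] is
    the trace of [A *m V]. *)
Lemma expectation_quadratic_form :
  centred X -> ('E_Pr[quadratic_form] = (\tr (A *m V))%:E)%E.
Proof.
move=> EX0; have [X_L2 covX] := X_cov.
have X_L1 s : (X s : T -> R) \in Lfun Pr 1%E.
  by apply: Lfun_subset12 => //; exact: fin_num_measure.
have EXX i j : ('E_Pr[X (enum_val i) \* X (enum_val j)] = (V i j)%:E)%E.
  rewrite -covX covarianceE; first by rewrite EX0 mul0e sube0.
  - exact: X_L1.
  - exact: X_L1.
  - exact: product_Lfun1.
rewrite quadratic_formE expectation_sum // big_map big_enum /=.
under eq_bigr do rewrite expectationZl // EXX -EFinM.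
rewrite sumEFin; congr _%:E.
rewrite -(pair_bigA _ (fun i j => A i j * V j i)) /=.
by rewrite /mxtrace; apply: eq_bigr => i _; rewrite mxE.
Qed.

End QuadraticForm.

(** * Transfer of idempotents along an equireplicate map *)

Section Lift.
Variables (R : realType) (A B : finType) (f : A -> B) (r : nat).
Hypotheses (f_equi : equireplicate f r) (r_gt0 : (0 < r)%N).
Local Notation X := (incidence_mx f : 'M[R]_(#|A|, #|B|)).

(** The columns of [X] are the indicators of the fibres of [f], which are disjoint and of size
    [r]. *)
Lemma incidence_gram : X^T *m X = r%:R%:M.
Proof.
apply/matrixP => i j; rewrite !mxE.
under eq_bigr do rewrite !mxE -natrM mulnb.
rewrite -natr_sum; have [<-|ij] := eqVneq i j; last first.
  rewrite big1 // => k _; case: eqP => // -> ; case: eqP => // /enum_val_inj ji.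
  by rewrite ji eqxx in ij.
have -> : r = (\sum_(a : A | f a == enum_val i) 1)%N.
  by rewrite sum1_card f_equi.
rewrite (reindex (@enum_val A A)) /=; last exact: onW_bij (@enum_val_bij A).
congr _%:R; rewrite [RHS]big_mkcond /=; apply: eq_bigr => k _.
by rewrite andbb; case: eqP.
Qed.

Let r_neq0 : r%:R != 0 :> R. Proof. by rewrite pnatr_eq0 -lt0n. Qed.

Lemma lift_mxM (M N : 'M[R]_#|B|) :
  lift_mx f r M *m lift_mx f r N = lift_mx f r (M *m N).
Proof.
rewrite /lift_mx -scalemxAl -scalemxAr scalerA.
rewrite -!mulmxA (mulmxA X^T X) incidence_gram mul_scalar_mx -!scalemxAr scalerA.
by rewrite mulfVK.
Qed.

Lemma lift_mx_trmx (M : 'M[R]_#|B|) : (lift_mx f r M)^T = lift_mx f r M^T.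
Proof. by rewrite /lift_mx linearZ /= !trmx_mul trmxK mulmxA. Qed.

Lemma lift_mx0 : lift_mx f r 0 = 0 :> 'M[R]_#|A|.
Proof. by rewrite /lift_mx mulmx0 mul0mx scaler0. Qed.

Lemma lift_mx_sum (J : finType) (M : J -> 'M[R]_#|B|) :
  \sum_j lift_mx f r (M j) = lift_mx f r (\sum_j M j).
Proof. by rewrite /lift_mx mulmx_sumr mulmx_suml scaler_sumr. Qed.

(** The lift of the identity is the orthogonal projector onto the column space of [X]. *)
Lemma lift_mx1_incidence : lift_mx f r 1%:M *m X = X.
Proof.
rewrite /lift_mx mulmx1 -scalemxAl -mulmxA incidence_gram mul_mx_scalar scalerA.
by rewrite mulVf // scale1r.
Qed.

End Lift.

(** * Algebra of the residual idempotent under structure balance *)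

Section Residual.
Variables (R : realType) (n : nat) (I J : finType).
Variables (P : I -> 'M[R]_n) (Q : J -> 'M[R]_n) (lambda : I -> J -> R).
Hypotheses (P_sym : forall i, (P i)^T = P i) (P_idem : forall i, P i *m P i = P i).
Hypothesis P_orth : forall i k, i != k -> P i *m P k = 0.
Hypotheses (Q_sym : forall j, (Q j)^T = Q j) (Q_idem : forall j, Q j *m Q j = Q j).
Hypothesis Q_orth : forall j k, j != k -> Q j *m Q k = 0.
Hypothesis PQ_balanced : structure_balanced P Q lambda.

(** Multiply the balance equation on the right by [Q k], which the sum of the family fixes. *)
Lemma balancedE i j k : Q j *m P i *m Q k = lambda i j *: (Q j *m Q k).
Proof.
have {1}<- : (\sum_l Q l) *m Q k = Q k.
  rewrite mulmx_suml (bigD1 k) //= Q_idem big1 ?addr0 // => l; exact: Q_orth.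
by rewrite mulmxA PQ_balanced -scalemxAl.
Qed.

(** Here [Q P Q = 0], and [Q P Q] is [(Q P)(Q P)^T]. *)
Lemma balanced_eq0 i j : lambda i j = 0 -> P i *m Q j = 0.
Proof.
move=> l0; apply: trmx_inj; rewrite trmx0 trmx_mul P_sym Q_sym.
apply: mulmx_trmx_eq0; rewrite trmx_mul P_sym Q_sym mulmxA.
by rewrite -(mulmxA (Q j)) P_idem balancedE l0 scale0r.
Qed.

Lemma residual_trmx i : (residual P Q lambda i)^T = residual P Q lambda i.
Proof.
rewrite /residual linearB /= linear_sum /= P_sym; congr (_ - _).
apply: eq_bigr => j _.
by rewrite /pertinent linearZ /= !trmx_mul P_sym Q_sym mulmxA.
Qed.

(** Each term satisfies [(P |> Q j) Q k = P Q j Q k], so only [j = k] can survive, and it cancels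
    [P Q k]. If [k] is left out because its coefficient is zero, [P Q k] already vanishes. *)
Lemma residual_mulQ i k : residual P Q lambda i *m Q k = 0.
Proof.
rewrite mulmxBl mulmx_suml; apply/eqP; rewrite subr_eq0; apply/eqP.
have term j : lambda i j != 0 ->
    pertinent (lambda i j) (P i) (Q j) *m Q k = P i *m (Q j *m Q k).
  move=> lj; rewrite /pertinent -scalemxAl -!mulmxA (mulmxA (Q j)) balancedE.
  by rewrite -scalemxAr scalerA mulVf // scale1r.
rewrite (eq_bigr _ term).
have [lk|lk] := eqVneq (lambda i k) 0.
  rewrite balanced_eq0 // big1 // => j lj.
  by rewrite Q_orth ?mulmx0 //; apply: contraNneq lj => ->; rewrite lk.
rewrite (bigD1 k) //= Q_idem big1 ?addr0 // => j /andP[_ jk].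
by rewrite Q_orth // mulmx0.
Qed.

Lemma residual_mulP i : residual P Q lambda i *m P i = residual P Q lambda i.
Proof.
rewrite mulmxBl mulmx_suml P_idem; congr (_ - _); apply: eq_bigr => j _.
by rewrite /pertinent -scalemxAl -!mulmxA P_idem.
Qed.

Lemma residual_mulP_neq i k : i != k -> residual P Q lambda i *m P k = 0.
Proof. by move=> ik; rewrite -residual_mulP -mulmxA P_orth // mulmx0. Qed.

(** Expanding the second factor leaves the residual times [P], since the residual kills each
    [Q j]. *)
Lemma residual_idem i :
  residual P Q lambda i *m residual P Q lambda i = residual P Q lambda i.
Proof.
rewrite {2}/residual mulmxBr residual_mulP mulmx_sumr big1 ?subr0 // => j _.
by rewrite /pertinent -scalemxAr !mulmxA residual_mulP residual_mulQ mul0mx scaler0.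
Qed.

Lemma residual_mul_cov (xi : I -> R) i :
  residual P Q lambda i *m (\sum_k xi k *: P k) = xi i *: residual P Q lambda i.
Proof.
rewrite mulmx_sumr (bigD1 i) //= -scalemxAr residual_mulP big1 ?addr0 // => k ki.
by rewrite -scalemxAr residual_mulP_neq ?scaler0 // eq_sym.
Qed.

End Residual.

(** * Expected mean square of the residual *)

Theorem mainTheorem3 (R : realType) (d : measure_display) (T : measurableType d)
  (Pr : probability T R)
  (Om Up Ga : finType) (f : Om -> Up) (h : Up -> Ga) (r : nat)
  (f_surj : forall u, exists w, f w = u)
  (h_surj : forall g, exists u, h u = g)
  (f_equi : equireplicate f r)
  (G1 : {group {perm Om}})
  (G1_trans : transitive_group G1) (G1_strat : stratifiable R G1)
  (I : finType) (P : I -> 'M[R]_#|Om|) (P_strata : stratum_projectors G1 P)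
  (G2 : {group {perm Up}})
  (G2_trans : transitive_group G2) (G2_strat : stratifiable R G2)
  (K : finType) (S : K -> 'M[R]_#|Up|) (S_strata : stratum_projectors G2 S)
  (J : finType) (parent : J -> K) (QU : J -> 'M[R]_#|Up|)
  (QU_refines : refinement S parent QU)
  (L : finType) (RU : L -> 'M[R]_#|Up|) (RU_idem : orth_idempotents RU)
  (RU_sum : \sum_l RU l = proj_incidence R h)
  (tau : Ga -> R) (xi : I -> R) (eta : J -> R)
  (xi_ge0 : forall i, 0 <= xi i) (eta_ge0 : forall j, 0 <= eta j)
  (eta_parent : forall j j', parent j = parent j' -> eta j = eta j')
  (Z : Om -> {RV Pr >-> R}) (W : Up -> {RV Pr >-> R})
  (ZW_indep : independent_vectors Z W)
  (Z_centred : centred Z) (W_centred : centred W)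
  (Z_cov : has_covariance Z (\sum_i xi i *: P i))
  (W_cov : has_covariance W (\sum_j eta j *: QU j))
  (lambdaPQ : I -> J -> R) (lambdaQR : J -> L -> R)
  (PQ_balanced :
     structure_balanced P (fun j => lift_mx f r (QU j)) lambdaPQ)
  (QR_balanced :
     structure_balanced (fun j => lift_mx f r (QU j))
                        (fun l => lift_mx f r (RU l)) lambdaQR)
  (i : I)
  (res_neq0 : residual P (fun j => lift_mx f r (QU j)) lambdaPQ i != 0) :
  expected_mean_square Pr
    (residual P (fun j => lift_mx f r (QU j)) lambdaPQ i)
    (response f h Z W tau)
  = (xi i)%:E.
Proof.
(* A nonzero residual forces [Om] to have a point [w], and the fibre of [f w] contains [w]. *)
have r_gt0 : (0 < r)%N.
  have /card_gt0P[w _] : (0 < #|Om|)%N.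
    rewrite lt0n; apply: contraNneq res_neq0 => Om0; apply/eqP/matrixP => k.
    by have := ltn_ord k; rewrite {2}Om0.
  by rewrite -(f_equi (f w)); apply/card_gt0P; exists w; rewrite inE.
have [P_inj strP] := P_strata.
have P_str k : stratum_projector G1 (P k) by apply/strP; exists k.
have P_sym k : (P k)^T = P k by case: (P_str k).
have P_idem k : P k *m P k = P k by case: (P_str k).
have P_orth k l : k != l -> P k *m P l = 0.
  by move=> kl; apply: stratum_projectors_orth (P_str k) (P_str l) _; rewrite (inj_eq P_inj).
have [[_ QU_sym QU_idem QU_orth] QU_sum] := QU_refines.
set Q := fun j => lift_mx f r (QU j) in PQ_balanced QR_balanced res_neq0 *.
have Q_sym j : (Q j)^T = Q j by rewrite lift_mx_trmx QU_sym.
have Q_idem j : Q j *m Q j = Q j by rewrite lift_mxM // QU_idem.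
have Q_orth j k : j != k -> Q j *m Q k = 0.
  by move=> jk; rewrite lift_mxM // QU_orth // lift_mx0.
(* Grouping the pieces by [parent] restores the strata of [G2], which sum to the identity. *)
have Q_sum : \sum_j Q j = lift_mx f r 1%:M.
  rewrite lift_mx_sum; congr lift_mx.
  rewrite (partition_big parent xpredT) //= -(sum_stratum_projectors G2_strat S_strata).
  by apply: eq_bigr => k _.
set A := residual P Q lambdaPQ i in res_neq0 *.
have A_sym : A^T = A by exact: residual_trmx.
have AA : A *m A = A by exact: residual_idem.
(* Write [X] as the projector [\sum_j Q j] times [X]; [A] kills every summand. *)
have AX : A *m incidence_mx f = 0.
  rewrite -(lift_mx1_incidence _ f_equi r_gt0) mulmxA -Q_sum mulmx_sumr.
  by rewrite big1 ?mul0mx // => j _; exact: residual_mulQ.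
have XA : (incidence_mx f)^T *m A = 0.
  by apply: trmx_inj; rewrite trmx_mul trmxK A_sym AX trmx0.
have rkA : (\rank A)%:R != 0 :> R by rewrite pnatr_eq0 mxrank_eq0.
(* Pointwise, the [W] and [tau] parts of the response both start with [X], so they vanish on either
   side of [A] and only [Z] remains. *)
have -> : expected_mean_square Pr A (response f h Z W tau) =
    ('E_Pr[(\rank A)%:R^-1 \o*
       (fun t => (((vec_of (Z^~ t))^T *m A *m vec_of (Z^~ t)) 0 0)%R)])%E.
  congr expectation; apply/funext => t; rewrite /mean_square /response /=.
  congr (_ 0 0 / _); rewrite -addrA -!mulmxA -mulmxDr.
  rewrite linearD /= trmx_mul mulmxDl -(mulmxA _ (incidence_mx f)^T).
  rewrite (mulmxA (incidence_mx f)^T) XA mul0mx mulmx0 addr0.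
  by rewrite (mulmxDr A) (mulmxA A) AX mul0mx addr0.
rewrite expectationZl; last exact: (quadratic_form_Lfun1 _ Z_cov).
rewrite (expectation_quadratic_form _ Z_cov Z_centred).
rewrite residual_mul_cov // linearZ /= mxtrace_idempotent // -EFinM.
by rewrite mulrC mulfK.
Qed.
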